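(* In the social learning model described in the context, with probability $1$ it holds that $\lim_{t\to\infty} \ell_t/t = 0$.
   Context: Social learning model. A state $\theta\in\{-1,+1\}$ is drawn with $\mathbb{P}(\theta=+1)=\mathbb{P}(\theta=-1)=1/2$. Agents $t=1,2,\dots$ receive private signals $s_t\in\mathbb{R}$ that are i.i.d. conditionally on $\theta$, with CDF $F_+$ if $\theta=+1$ and $F_-$ if $\theta=-1$; $F_+$ and $F_-$ are mutually absolutely continuous. Let $L_t=\log\frac{\mathbb{P}(\theta=+1\mid s_t)}{\mathbb{P}(\theta=-1\mid s_t)}$ be the private log-likelihood ratio, and let $G_+$, $G_-$ denote the CDFs of $L_t$ conditional on $\theta=+1$, $\theta=-1$ respectively. Signals are assumed unbounded: for every $M\in\mathbb{R}$, $\mathbb{P}(L_t>M)>0$ and $\mathbb{P}(L_t<-M)>0$. Agent $t$ observes $a_1,\dots,a_{t-1}$ and her own signal and chooses $a_t\in\{-1,+1\}$ (utility $1$ if $a_t=\theta$, else $0$). The public belief is $\mu_t=\mathbb{P}(\theta=+1\mid a_1,\dots,a_{t-1})$ and $\ell_t=\log\frac{\mu_t}{1-\mu_t}$ (so $\ell_1=0$). In equilibrium $a_t=+1$ iff $\ell_t+L_t>0$, and otherwise $a_t=-1$. Consequently $\ell_{t+1}=\ell_t+D_+(\ell_t)$ if $a_t=+1$ and $\ell_{t+1}=\ell_t+D_-(\ell_t)$ if $a_t=-1$, where $D_+(x)=\log\frac{1-G_+(-x)}{1-G_-(-x)}$ and $D_-(x)=\log\frac{G_+(-x)}{G_-(-x)}$.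 We write $\mathbb{P}_+(\cdot)=\mathbb{P}(\cdot\mid\theta=+1)$ and $\mathbb{E}_+$ for the corresponding expectation. *)

(* Defs.v *)
From HB Require Import structures.
From mathcomp Require Import all_boot all_order all_algebra.
From mathcomp Require Import all_classical all_reals all_analysis.
Set Implicit Arguments. Unset Strict Implicit. Unset Printing Implicit Defensive.
Import Order.TTheory GRing.Theory Num.Theory.
Local Open Scope classical_set_scope.
Local Open Scope ring_scope.

Definition llr_cdf (R : realType) (F : probability R R) (lr : R -> R) (x : R) : R :=
  fine (F [set s | lr s <= x]).

Definition Dplus (R : realType) (Fp Fm : probability R R) (lr : R -> R) (x : R) : R :=
  ln ((1 - llr_cdf Fp lr (- x)) / (1 - llr_cdf Fm lr (- x))).

Definition Dminus (R : realType) (Fp Fm : probability R R) (lr : R -> R) (x : R) : R :=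
  ln (llr_cdf Fp lr (- x) / llr_cdf Fm lr (- x)).

(* Public log-likelihood ratio, given the realized private LLRs L.
   Index shift: public_llr n = ell_{n+1} of the paper (so public_llr 0 = ell_1 = 0),
   and L n = L_{n+1}.  Agent n+1 plays +1 iff ell_{n+1} + L_{n+1} > 0. *)
Fixpoint public_llr (R : realType) (Fp Fm : probability R R) (lr : R -> R)
    (L : nat -> R) (n : nat) : R :=
  match n with
  | 0%N => 0
  | n'.+1 =>
      let l := public_llr Fp Fm lr L n' in
      if 0 < l + L n' then l + Dplus Fp Fm lr l else l + Dminus Fp Fm lr l
  end.

(* Main.v *)
(** Conditionally on [theta = +1] the process [expR (- ell_t)] is a nonnegative
    martingale (it is the likelihood ratio of the actions), so by the maximal
    inequality it is almost surely bounded: [ell_t >= - M] for all [t].  From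
    there on the argument is pathwise.  [D_- <= 0], and [D_+(x)] is dominated by
    the nonincreasing function [- ln (1 - G_-(- x))], which tends to 0 at
    infinity; hence the upward steps are bounded, and are at most [e] above some
    level [K], so that [ell_t <= const + e * t].  The case [theta = -1] is
    symmetric, with [expR ell_t].  No convergence of beliefs is needed. *)

Require Import Defs.
From HB Require Import structures.
From mathcomp Require Import all_boot all_order all_algebra.
From mathcomp Require Import all_classical all_reals all_analysis.
From mathcomp Require Import measurable_realfun ring lra.
Import Order.TTheory GRing.Theory Num.Theory.
Local Open Scope classical_set_scope.
Local Open Scope ring_scope.

(** * Deterministic sublinear growth *)

(** Since [H] is nonincreasing, every step is at most [H M], and every step from above a suitable
    level [K] is at most [e / 2]. Hence [u] stays below a line of slope [e / 2], while [M] bounds it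
    below. *)
Lemma cvg_div_succ0 (R : realType) (u : nat -> R) (H : R -> R) (M : R) :
  (forall n, M <= u n) -> {homo H : x y / x <= y >-> y <= x} ->
  (forall e : R, 0 < e -> exists K, H K <= e) ->
  (forall n, u n.+1 <= u n + H (u n)) ->
  (fun n => u n / n.+1%:R) @ \oo --> 0%R.
Proof.
move=> uM Hanti H0 uH; apply/cvgrPdist_le => e e0.
have [K hK] := H0 (e / 2) (divr_gt0 e0 (ltr0Sn R 1)).
pose C := H M.
have uC n : u n.+1 <= u n + C by apply: (le_trans (uH n)); rewrite lerD2l Hanti.
(* [A] dominates both the start [u 0] and [K + C], the highest point that one step from below [K]
   can reach. *)
pose A := `|u 0%N| + `|K| + `|C|.
have ub n : u n <= A + e / 2 * n%:R.
  elim: n => [|n IH].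
    by have := ler_norm (u 0%N); have := normr_ge0 K; have := normr_ge0 C; rewrite /A; lra.
  have n0 : 0 <= e / 2 * n%:R by rewrite mulr_ge0// divr_ge0// ltW.
  rewrite -[n.+1%:R]natr1.
  have [Ku|uK] := leP K (u n); first by have := Hanti _ _ Ku; have := uH n; lra.
  have := uC n; have := ler_norm K; have := ler_norm C; have := normr_ge0 (u 0%N).
  by rewrite /A; lra.
(* Beyond [B], the constants [A] and [|M|] use at most half of [e * n.+1]; the slope [e / 2] uses
   the other half. *)
pose B := 2 * (A + `|M|) / e.
near=> n.
have nB : B <= n.+1%:R.
  near: n; exists (Num.truncn B) => // n /= Bn.
  by apply: ltW; apply: lt_le_trans (truncnS_gt _) _; rewrite ler_nat.
have {}nB : 2 * (A + `|M|) <= e * n.+1%:R by rewrite [e * _]mulrC -ler_pdivrMr.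
have An : 0 <= A by rewrite !addr_ge0.
rewrite sub0r normrN normrM [X in _ * X]ger0_norm// ler_pdivrMr// ler_norml.
have := uM n; have := ub n; have := ler_norm (- M); have := normr_ge0 M; rewrite normrN.
move: nB; rewrite -[n.+1%:R]natr1 => nB h1 h2 h3 h4.
have en : 0 <= e * n%:R by rewrite mulr_ge0// ltW.
by apply/andP; split; lra.
Unshelve. all: by end_near. Qed.

(** * A maximal inequality for chains driven by i.i.d. signals *)

Section maximal_inequality.
Context {R : realType} {d : measure_display} {T : measurableType d}.
Variables (P : probability T R) (S : Type) (s : nat -> T -> R).
Variables (U : S -> pred R) (a b : S -> S).

(** The starting time [k] is kept apart from the number of steps [n], so that the chain can be
    restarted after its first signal. *)
Fixpoint chain (k : nat) (x : S) (n : nat) (w : T) : S :=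
  if n is n'.+1 then
    let y := chain k x n' w in if U y (s (k + n') w) then a y else b y
  else x.

Lemma chainS k x n w :
  chain k x n.+1 w = chain k.+1 (if U x (s k w) then a x else b x) n w.
Proof.
by elim: n => [|n IH]; [rewrite /= addn0 | rewrite /= -/(chain k x n.+1 w) IH addnS].
Qed.

Variable h : S -> R.

Definition exceeds (c : R) (k : nat) (x : S) (n : nat) : set T :=
  [set w | exists2 j, (j <= n)%N & c <= h (chain k x j w)].

Lemma exceeds0 c k x : exceeds c k x 0 = [set w | c <= h x].
Proof.
apply/seteqP; split => w /=; first by case=> j; rewrite leqn0 => /eqP ->.
by exists 0%N.
Qed.

(** First-step analysis: below level [c] at the start, the event is passed on to the chain restarted
    at time [k.+1]. This drives both measurability and the induction on the horizon. *)
Lemma exceedsS c k x n : exceeds c k x n.+1 =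
  [set w | c <= h x] `|`
  (s k @^-1` [set y | U x y] `&` exceeds c k.+1 (a x) n `|`
   s k @^-1` (~` [set y | U x y]) `&` exceeds c k.+1 (b x) n).
Proof.
apply/seteqP; split => w /=.
  case=> -[_ cx|j]; first by left.
  rewrite ltnS => jn; rewrite chainS; case: ifPn => Ux cj; right; [left|right].
    by split => //; exists j.
  by split; [exact/negP|exists j].
case=> [cx|]; first by exists 0%N.
case=> -[Ux [j jn cj]]; exists j.+1 => //; rewrite chainS; first by rewrite Ux.
by rewrite (negbTE (introN idP Ux)).
Qed.

Hypothesis s_meas : forall n, measurable_fun setT (s n).
Hypothesis U_meas : forall x, measurable [set y | U x y].

Lemma measurable_exceeds c k x n : measurable (exceeds c k x n).
Proof.
have mc y : measurable [set w : T | c <= h y].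
  case: (c <= h y); last by rewrite (_ : [set _ | _] = set0)//; apply/seteqP; split.
  by rewrite (_ : [set _ | _] = setT)//; apply/seteqP; split.
have ms k' A : measurable A -> measurable (s k' @^-1` A).
  by move=> mA; rewrite -[X in measurable X]setTI; exact: s_meas.
elim: n k x => [|n IH] k x; first by rewrite exceeds0.
rewrite exceedsS; apply: measurableU => //; apply: measurableU; apply: measurableI => //; apply: ms => //.
exact: measurableC.
Qed.

Variables (E : set T) (q : R) (F : probability R R).
Hypothesis E_meas : measurable E.
Hypothesis q_ge0 : 0 <= q.
(** Conditioning on [E] is kept unnormalised; the case [n = 0] says that [q] is the probability of
    [E]. *)
Hypothesis iid : forall (n : nat) (B : nat -> set R), (forall i, measurable (B i)) ->
  P (E `&` \bigcap_(i < n) (s i @^-1` B i)) = (q%:E * \prod_(i < n) F (B i))%E.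
Hypothesis h_ge0 : forall x, 0 <= h x.
Hypothesis h_super : forall x,
  (F [set y | U x y] * (h (a x))%:E + F (~` [set y | U x y]) * (h (b x))%:E
    <= (h x)%:E)%E.

(* The finite-horizon maximal inequality is proved for a chain started at time
   [k], on an arbitrary cylinder of the past: revealing the [k]-th signal
   splits the cylinder into two cylinders of length [k.+1]. *)
Lemma cylinder_exceeds_le c k x n (B : nat -> set R) : 0 < c ->
  (forall i, measurable (B i)) ->
  (P (E `&` \bigcap_(i < k) (s i @^-1` B i) `&` exceeds c k x n)
    <= q%:E * \prod_(i < k) F (B i) * (h x / c)%:E)%E.
Proof.
move=> c0.
have ms k' A : measurable A -> measurable (s k' @^-1` A).
  by move=> mA; rewrite -[X in measurable X]setTI; exact: s_meas.
have mcyl k' B' : (forall i, measurable (B' i)) ->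
    measurable (E `&` \bigcap_(i < k') (s i @^-1` B' i)).
  move=> mB; apply: measurableI => //; apply: bigcap_measurableType => i _.
  exact: ms.
have prod_ge0 k' B' : (0 <= q%:E * \prod_(i < k') F (B' i))%E.
  by rewrite mule_ge0 ?lee_fin//; apply: prode_ge0 => i _; exact: measure_ge0.
(* If the chain starts at or above [c], the factor [h x' / c] is at least 1 and the probability of
   the cylinder alone suffices. *)
have large k' x' n' B' : (forall i, measurable (B' i)) -> c <= h x' ->
    (P (E `&` \bigcap_(i < k') (s i @^-1` B' i) `&` exceeds c k' x' n')
    <= q%:E * \prod_(i < k') F (B' i) * (h x' / c)%:E)%E.
  move=> mB cx; apply: (@le_trans _ _ (P (E `&` \bigcap_(i < k') (s i @^-1` B' i)))).
    apply: le_measure; rewrite ?inE; [|exact: mcyl|exact: subIsetl].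
    by apply: measurableI; [exact: mcyl|exact: measurable_exceeds].
  rewrite iid// -[leLHS]mule1; apply: lee_pmul => //.
  by rewrite lee_fin ler_pdivlMr// mul1r.
elim: n k x B => [|n IH] k x B mB; have [cx|xc] := leP c (h x); try exact: large.
  have -> : exceeds c k x 0 = set0.
    by rewrite exceeds0; apply/seteqP; split => w //=; rewrite leNgt xc.
  by rewrite setI0 measure0 mule_ge0// lee_fin divr_ge0// ltW.
(* Only the value at [i = k] matters beyond [B], because the extended cylinders have length
   [k.+1]. *)
pose ext V i := if (i < k)%N then B i else V.
have mext V : measurable V -> forall i, measurable (ext V i).
  by move=> mV i; rewrite /ext; case: ifP.
have prod_ext V : (\prod_(i < k.+1) F (ext V i) = \prod_(i < k) F (B i) * F V)%E.
  rewrite big_ord_recr /= {2}/ext ltnn; congr (_ * _)%E.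
  by apply: eq_bigr => i _; rewrite /ext ltn_ord.
have cyl_ext V w : (E `&` \bigcap_(i < k) (s i @^-1` B i)) w -> V (s k w) ->
    (E `&` \bigcap_(i < k.+1) (s i @^-1` ext V i)) w.
  case=> Ew Bw Vw; split => // i /=; rewrite ltnS leq_eqVlt /ext => /orP[/eqP ->|ik].
    by rewrite ltnn.
  by rewrite ik; exact: Bw.
pose V := [set y | U x y].
have mV : measurable V by exact: U_meas.
have mCV := measurableC mV.
pose cyl W := E `&` \bigcap_(i < k.+1) (s i @^-1` ext W i).
have mW W x' : measurable W -> measurable (cyl W `&` exceeds c k.+1 x' n).
  by move=> mW; apply: measurableI; [exact: mcyl (mext _ mW)|exact: measurable_exceeds].
apply: (@le_trans _ _ (P (cyl V `&` exceeds c k.+1 (a x) n `|`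
                          cyl (~` V) `&` exceeds c k.+1 (b x) n))).
  apply: le_measure; rewrite ?inE.
  - by apply: measurableI; [exact: mcyl|exact: measurable_exceeds].
  - by apply: measurableU; exact: mW.
  - move=> w [cw]; rewrite exceedsS => -[/=|]; first by rewrite leNgt xc.
    by case=> -[Vw hw]; [left|right]; split => //; exact: cyl_ext.
apply: (@le_trans _ _ (P (cyl V `&` exceeds c k.+1 (a x) n) +
                       P (cyl (~` V) `&` exceeds c k.+1 (b x) n))%E).
  by apply: measureU2; exact: mW.
(* The two inductive bounds share the past's probability and the factor [1 / c]; what remains is
   [h_super] at [x]. *)
apply: (le_trans (leeD (IH k.+1 (a x) _ (mext _ mV)) (IH k.+1 (b x) _ (mext _ mCV)))).
rewrite !prod_ext !muleA -!(muleA (q%:E * _)%E) -ge0_muleDr ?mule_ge0 ?measure_ge0//;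
  try by rewrite lee_fin divr_ge0// ltW.
apply: lee_pmul => //.
  by rewrite adde_ge0// mule_ge0 ?measure_ge0// lee_fin divr_ge0// ltW.
rewrite !EFinM !muleA -ge0_muleDl ?mule_ge0 ?measure_ge0 ?lee_fin//.
by apply: lee_wpmul2r; [rewrite lee_fin invr_ge0 ltW|exact: h_super].
Qed.

(** Letting the horizon grow, [h] exceeds [m.+1] on [E] with probability at most [q * h x / m.+1].
    Unbounded paths lie in all these events, hence in a null set. *)
Lemma ae_bounded_supermartingale x :
  {ae P, forall w, E w -> exists M, forall n, h (chain 0 x n w) <= M}.
Proof.
have mex m : measurable (\bigcup_n exceeds m.+1%:R 0 x n).
  by apply: bigcupT_measurable => n; exact: measurable_exceeds.
pose N m := E `&` \bigcup_n exceeds m.+1%:R 0 x n.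
have mN m : measurable (N m) by exact: measurableI.
have PN m : (P (N m) <= (q * h x / m.+1%:R)%:E)%E.
  pose G n := E `&` exceeds m.+1%:R 0 x n.
  have mG n : measurable (G n) by apply: measurableI => //; exact: measurable_exceeds.
  have NG : N m = \bigcup_n G n by rewrite /N setI_bigcupr.
  have PG : P \o G @ \oo --> P (\bigcup_n G n).
    apply: nondecreasing_cvg_mu => //; first exact: bigcupT_measurable.
    move=> i j ij; apply/subsetPset => w [Ew [l li hl]]; split => //.
    by exists l => //; exact: leq_trans li ij.
  rewrite NG -(cvg_lim _ PG)//; apply: lime_le; first by apply/cvg_ex; exists (P (\bigcup_n G n)).
  apply: nearW => n /=.
  have := @cylinder_exceeds_le m.+1%:R 0 x n (fun=> setT) (ltr0Sn _ _) (fun=> measurableT).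
  rewrite big_ord0 mule1 -EFinM mulrA; apply: le_trans; rewrite le_eqVlt; apply/orP; left.
  apply/eqP; congr (P _); apply/seteqP; split => w [Ew hw]; first by split.
  by case: Ew.
exists (\bigcap_m N m); split.
- exact: bigcapT_measurable.
- apply/eqP; rewrite eq_le measure_ge0 andbT.
  apply/lee_addgt0Pr => e e0; rewrite add0e.
  pose m := Num.truncn (q * h x / e).
  apply: (@le_trans _ _ (P (N m))).
    apply: le_measure; rewrite ?inE//; first exact: bigcapT_measurable.
    exact: bigcap_inf.
  apply: (le_trans (PN m)); rewrite lee_fin ler_pdivrMr// [e * _]mulrC -ler_pdivrMr//.
  exact/ltW/truncnS_gt.
- move=> w /= /not_implyP[Ew nb] m _; split => //.
  apply: contrapT => nex; apply: nb; exists m.+1%:R => n; rewrite leNgt; apply/negP => hm.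
  by apply: nex; exists n => //; exists n => //; exact: ltW.
Qed.

End maximal_inequality.

(** * Distribution functions of the private log-likelihood ratio *)

Section llr_cdf.
Context {R : realType}.
Variables (F : probability R R) (lr : R -> R).
Hypothesis lr_meas : measurable_fun setT lr.

Lemma measurable_llr_le (x : R) : measurable [set y | lr y <= x].
Proof.
rewrite (_ : [set y | _] = setT `&` lr @^-1` `]-oo, x]); first exact: lr_meas.
by rewrite setTI; apply/seteqP; split => y /=; rewrite in_itv.
Qed.

Lemma setC_llr_le (x : R) : ~` [set y | lr y <= x] = [set y | x < lr y].
Proof. by apply/seteqP; split => y /=; rewrite ltNge => /negP. Qed.

Lemma llr_cdfE (x : R) : F [set y | lr y <= x] = (llr_cdf F lr x)%:E.
Proof. by rewrite fineK// fin_num_measure//; exact: measurable_llr_le. Qed.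

Lemma llr_cdfC (x : R) : F [set y | x < lr y] = (1 - llr_cdf F lr x)%:E.
Proof.
by rewrite -setC_llr_le probability_setC ?llr_cdfE//; exact: measurable_llr_le.
Qed.

Lemma le_llr_cdf : {homo llr_cdf F lr : x y / x <= y}.
Proof.
move=> x y xy; rewrite -lee_fin -!llr_cdfE; apply: le_measure; rewrite ?inE;
  try exact: measurable_llr_le.
by move=> z /= /le_trans; exact.
Qed.

(** Packaging [lr] as a random variable gives access to the limits of [cdf] at both infinities. *)
Let X : {RV F >-> R} := HB.pack lr (isMeasurableFun.Build _ _ _ _ lr lr_meas).

Let cdfX : cdf X = EFin \o llr_cdf F lr.
Proof.
by apply/funext => x; rewrite /= -llr_cdfE /cdf /distribution /pushforward; congr (F _).
Qed.

Lemma llr_cdf_lt_near_ninfty (e : R) : 0 < e -> exists K, llr_cdf F lr K < e.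
Proof.
move=> e0; have := cvg_cdfNy0 X; rewrite cdfX => /fine_cvg/cvgr_lt/(_ e e0).
by move=> /(@filter_ex _ _ _)[K]; exists K.
Qed.

Lemma llr_cdf_gt_near_pinfty (e : R) : e < 1 -> exists K, e < llr_cdf F lr K.
Proof.
move=> e1; have := cvg_cdfy1 X; rewrite cdfX => /fine_cvg/cvgr_gt/(_ e e1).
by move=> /(@filter_ex _ _ _)[K]; exists K.
Qed.

End llr_cdf.

(** * Increments of the public log-likelihood ratio and its growth in each state *)

Section public_llr.
Context {R : realType}.
Variables (Fp Fm : probability R R) (lr : R -> R).
Hypothesis lr_meas : measurable_fun setT lr.
Hypothesis lr_density : forall B : set R, measurable B ->
  Fp B = (\int[Fm]_(x in B) (expR (lr x))%:E)%E.
Hypothesis lr_unbounded : forall x : R,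
  [/\ (0 < Fp [set y | (lr y <= x)%R])%E, (0 < Fm [set y | (lr y <= x)%R])%E,
      (0 < Fp [set y | (x < lr y)%R])%E & (0 < Fm [set y | (x < lr y)%R])%E].

Local Notation Gp := (llr_cdf Fp lr).
Local Notation Gm := (llr_cdf Fm lr).

Let Gp_gt0 x : 0 < Gp x.
Proof. by have [+ _ _ _] := lr_unbounded x; rewrite llr_cdfE. Qed.

Let Gm_gt0 x : 0 < Gm x.
Proof. by have [_ + _ _] := lr_unbounded x; rewrite llr_cdfE. Qed.

Let Gp_lt1 x : 0 < 1 - Gp x.
Proof. by have [_ _ + _] := lr_unbounded x; rewrite llr_cdfC. Qed.

Let Gm_lt1 x : 0 < 1 - Gm x.
Proof. by have [_ _ _ +] := lr_unbounded x; rewrite llr_cdfC. Qed.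

(* The density [expR lr] is at most 1 on [lr <= x] when [x <= 0], and at least 1
   on [x < lr] when [0 <= x]. *)
Lemma llr_cdf_plus_le_minus (x : R) : Gp x <= Gm x.
Proof.
have mlr D : measurable D -> measurable_fun D (fun y => (expR (lr y))%:E).
  move=> mD; apply/measurable_EFinP; apply: measurable_funTS.
  exact: (measurableT_comp (@measurable_expR R) lr_meas).
have [x0|x0] := leP x 0.
  have mD : measurable [set y | lr y <= x] by exact: measurable_llr_le.
  rewrite -lee_fin -!llr_cdfE// lr_density// -[leRHS]mul1e -integral_cst//.
  apply: ge0_le_integral => //; [exact: mlr|move=> y /= yx].
  by rewrite lee_fin -expR0 ler_expR (le_trans yx).
have mD : measurable [set y | x < lr y].
  by rewrite -setC_llr_le; apply: measurableC; exact: measurable_llr_le.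
suff : 1 - Gm x <= 1 - Gp x by lra.
rewrite -lee_fin -!llr_cdfC// lr_density// -[leLHS]mul1e -integral_cst//.
apply: ge0_le_integral => //; [exact: mlr|move=> y /= xy].
by rewrite lee_fin -expR0 ler_expR ltW// (lt_trans x0).
Qed.

Let posE (x : R) : 0 < x -> x \in Num.pos. Proof. by []. Qed.

Lemma Dplus_ge0 x : 0 <= Dplus Fp Fm lr x.
Proof.
apply: ln_ge0; rewrite ler_pdivlMr// mul1r.
by have := llr_cdf_plus_le_minus (- x); lra.
Qed.

Lemma Dminus_le0 x : Dminus Fp Fm lr x <= 0.
Proof. by apply: ln_le0; rewrite ler_pdivrMr// mul1r llr_cdf_plus_le_minus. Qed.

(** Bounding the numerator [1 - Gp (- x)] by 1 leaves a function that is monotone in [x], as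
    [cvg_div_succ0] requires. *)
Lemma Dplus_le x : Dplus Fp Fm lr x <= - ln (1 - Gm (- x)).
Proof.
rewrite /Dplus ln_div ?posE// gerDr; apply: ln_le0.
by have := Gp_gt0 (- x); lra.
Qed.

Lemma Dminus_ge x : ln (Gp (- x)) <= Dminus Fp Fm lr x.
Proof.
rewrite /Dminus ln_div ?posE// lerDl oppr_ge0; apply: ln_le0.
by have := Gm_lt1 (- x); lra.
Qed.

(** The martingale identity in state +1: each action probability cancels the denominator of its
    likelihood ratio, leaving [(1 - Gm (- x)) + Gm (- x) = 1]. *)
Lemma expR_llr_plus x :
  (1 - Gp (- x)) * expR (- (x + Dplus Fp Fm lr x)) +
  Gp (- x) * expR (- (x + Dminus Fp Fm lr x)) = expR (- x).
Proof.
rewrite !opprD !expRD !expRN /Dplus /Dminus !lnK ?posE ?divr_gt0//.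
have := Gp_gt0 (- x); have := Gp_lt1 (- x); have := Gm_gt0 (- x); have := Gm_lt1 (- x).
move=> /lt0r_neq0 h1 /lt0r_neq0 h2 /lt0r_neq0 h3 /lt0r_neq0 h4.
have h5 : expR x != 0 by rewrite gt_eqF ?expR_gt0.
by field; rewrite h1 h2 h3 h4 h5.
Qed.

Lemma expR_llr_minus x :
  (1 - Gm (- x)) * expR (x + Dplus Fp Fm lr x) +
  Gm (- x) * expR (x + Dminus Fp Fm lr x) = expR x.
Proof.
rewrite !expRD /Dplus /Dminus !lnK ?posE ?divr_gt0//.
have := Gm_gt0 (- x); have := Gm_lt1 (- x) => /lt0r_neq0 h1 /lt0r_neq0 h2.
by field; rewrite h1 h2.
Qed.

Lemma public_llr_div_cvg_plus (L : nat -> R) (M : R) :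
  (forall n, expR (- public_llr Fp Fm lr L n) <= M) ->
  (fun n => public_llr Fp Fm lr L n / n.+1%:R) @ \oo --> 0%R.
Proof.
move=> bM.
have M0 : 0 < M by apply: lt_le_trans (bM 0%N); exact: expR_gt0.
pose H x := - ln (1 - Gm (- x)).
apply: (@cvg_div_succ0 _ _ H (- ln M)) => [n|x y xy|e e0|n].
- by rewrite lerNl -ler_expR lnK ?posE.
- rewrite /H lerN2 ler_ln ?posE//.
  by have := @le_llr_cdf _ Fm _ lr_meas (- y) (- x); rewrite lerN2 xy => /(_ isT); lra.
(* [H x <= e] amounts to [Gm (- x) <= 1 - expR (- e)], which holds once [- x] is far enough to the
   left. *)
- have [|K hK] := @llr_cdf_lt_near_ninfty _ Fm _ lr_meas (1 - expR (- e)).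
    by rewrite subr_gt0 -expR0 ltr_expR oppr_lt0.
  by exists (- K); rewrite /H opprK lerNl -ler_expR lnK ?posE//; lra.
- rewrite /=; case: ifP => _; rewrite lerD2l; first exact: Dplus_le.
  apply: (le_trans (Dminus_le0 _)); exact: le_trans (Dplus_ge0 _) (Dplus_le _).
Qed.

(** The mirror image: [cvg_div_succ0] is applied to the negated process, whose upward steps are the
    values [- D_-]. As [H] takes the negated state, [Gp] appears without a sign change. *)
Lemma public_llr_div_cvg_minus (L : nat -> R) (M : R) :
  (forall n, expR (public_llr Fp Fm lr L n) <= M) ->
  (fun n => public_llr Fp Fm lr L n / n.+1%:R) @ \oo --> 0%R.
Proof.
move=> bM.
have M0 : 0 < M by apply: lt_le_trans (bM 0%N); exact: expR_gt0.
pose H x := - ln (Gp x).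
suff : (fun n => - public_llr Fp Fm lr L n / n.+1%:R) @ \oo --> 0%R.
  move=> /cvgN; rewrite oppr0; apply: cvg_trans; apply: near_eq_cvg.
  by apply: nearW => n; rewrite fctE mulNr opprK.
apply: (@cvg_div_succ0 _ (fun n => - public_llr Fp Fm lr L n) H (- ln M)) => [n|x y xy|e e0|n].
- by rewrite lerN2 -ler_expR lnK ?posE.
- by rewrite /H lerN2 ler_ln ?posE// le_llr_cdf.
- have [|K hK] := @llr_cdf_gt_near_pinfty _ Fp _ lr_meas (expR (- e)).
    by rewrite -expR0 ltr_expR oppr_lt0.
  by exists K; rewrite /H lerNl -ler_expR lnK ?posE// ltW.
- have Hl : - Dminus Fp Fm lr (public_llr Fp Fm lr L n) <= H (- public_llr Fp Fm lr L n).
    by rewrite lerN2 Dminus_ge.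
  rewrite /=; case: ifP => _; rewrite opprD lerD2l//.
  apply: le_trans Hl; have := Dminus_le0 (public_llr Fp Fm lr L n).
  by have := Dplus_ge0 (public_llr Fp Fm lr L n); lra.
Qed.

Context {d : measure_display} {T : measurableType d}.
Variables (P : probability T R) (E : set T) (q : R) (s : nat -> T -> R).
Hypothesis E_meas : measurable E.
Hypothesis q_ge0 : 0 <= q.
Hypothesis s_meas : forall n, measurable_fun setT (s n).

Let U (x : R) : pred R := fun y => 0 < x + lr y.

Let U_E x : [set y | U x y] = [set y | - x < lr y].
Proof. by apply/seteqP; split => y /=; rewrite /U addrC -ltrBlDr sub0r. Qed.

Let U_EC x : ~` [set y | U x y] = [set y | lr y <= - x].
Proof. by rewrite U_E -setC_llr_le setCK. Qed.

Let U_meas x : measurable [set y | U x y].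
Proof. by rewrite U_E -setC_llr_le; apply: measurableC; exact: measurable_llr_le. Qed.

(** The public log-likelihood ratio is a chain whose state is the ratio itself and whose test [U] is
    the decision rule for action +1. *)
Let chainE n w :
  chain _ s U (fun x => x + Dplus Fp Fm lr x) (fun x => x + Dminus Fp Fm lr x) 0 0 n w =
  public_llr Fp Fm lr (fun k => lr (s k w)) n.
Proof. by elim: n => //= n ->. Qed.

Lemma ae_public_llr_div_cvg_plus :
  (forall (n : nat) (B : nat -> set R), (forall i, measurable (B i)) ->
    P (E `&` \bigcap_(i < n) (s i @^-1` B i)) = (q%:E * \prod_(i < n) Fp (B i))%E) ->
  {ae P, forall w, E w ->
    (fun n => public_llr Fp Fm lr (fun k => lr (s k w)) n / n.+1%:R) @ \oo --> 0%R}.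
Proof.
move=> iid.
have := @ae_bounded_supermartingale _ _ _ P _ s U (fun x => x + Dplus Fp Fm lr x)
  (fun x => x + Dminus Fp Fm lr x) (fun x => expR (- x)) s_meas U_meas
  E q Fp E_meas q_ge0 iid (fun x => expR_ge0 _) _ 0.
have super x : (Fp [set y | U x y] * (expR (- (x + Dplus Fp Fm lr x))%R)%:E +
  Fp (~` [set y | U x y]) * (expR (- (x + Dminus Fp Fm lr x))%R)%:E <= (expR (- x)%R)%:E)%E.
  by rewrite U_EC U_E llr_cdfE// llr_cdfC// -!EFinM -EFinD expR_llr_plus.
move=> /(_ super); apply: filterS => w + Ew => /(_ Ew)[M bM].
by apply: (@public_llr_div_cvg_plus _ M) => n; rewrite -chainE.
Qed.

Lemma ae_public_llr_div_cvg_minus :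
  (forall (n : nat) (B : nat -> set R), (forall i, measurable (B i)) ->
    P (E `&` \bigcap_(i < n) (s i @^-1` B i)) = (q%:E * \prod_(i < n) Fm (B i))%E) ->
  {ae P, forall w, E w ->
    (fun n => public_llr Fp Fm lr (fun k => lr (s k w)) n / n.+1%:R) @ \oo --> 0%R}.
Proof.
move=> iid.
have := @ae_bounded_supermartingale _ _ _ P _ s U (fun x => x + Dplus Fp Fm lr x)
  (fun x => x + Dminus Fp Fm lr x) (@expR R) s_meas U_meas
  E q Fm E_meas q_ge0 iid (fun x => expR_ge0 _) _ 0.
have super x : (Fm [set y | U x y] * (expR (x + Dplus Fp Fm lr x)%R)%:E +
  Fm (~` [set y | U x y]) * (expR (x + Dminus Fp Fm lr x)%R)%:E <= (expR x)%:E)%E.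
  by rewrite U_EC U_E llr_cdfE// llr_cdfC// -!EFinM -EFinD expR_llr_minus.
move=> /(_ super); apply: filterS => w + Ew => /(_ Ew)[M bM].
by apply: (@public_llr_div_cvg_minus _ M) => n; rewrite -chainE.
Qed.

End public_llr.

(** * Positivity of the tails and assembly of the two states *)

Theorem theorem1
  (R : realType) (d : measure_display) (T : measurableType d)
  (P : probability T R)
  (theta : T -> bool) (* theta w = true  <->  state +1 *)
  (s : nat -> T -> R) (* s n = private signal of agent n+1 *)
  (Fp Fm : probability R R) (* signal laws F_+ and F_- *)
  (lr : R -> R) (* private log-likelihood ratio as a function of the signal *)
  (htheta_meas : measurable [set w | theta w])
  (hs_meas : forall n, measurable_fun setT (s n))
  (hprior : P [set w | theta w] = (1 / 2 : R)%:E)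
  (hcond_iid_p : forall (n : nat) (B : nat -> set R),
      (forall i, measurable (B i)) ->
      P ([set w | theta w] `&` \bigcap_(i < n) (s i @^-1` B i))
        = ((1 / 2 : R)%:E * \prod_(i < n) Fp (B i))%E)
  (hcond_iid_m : forall (n : nat) (B : nat -> set R),
      (forall i, measurable (B i)) ->
      P ([set w | ~~ theta w] `&` \bigcap_(i < n) (s i @^-1` B i))
        = ((1 / 2 : R)%:E * \prod_(i < n) Fm (B i))%E)
  (hac_pm : Fp `<< Fm) (hac_mp : Fm `<< Fp)
  (hlr_meas : measurable_fun setT lr)
  (hlr : forall B : set R, measurable B ->
      Fp B = (\int[Fm]_(x in B) (expR (lr x))%:E)%E)
  (hunbounded : forall (t : nat) (M : R),
      (0 < P [set w | (M < lr (s t w))%R])%E /\ (0 < P [set w | (lr (s t w) < - M)%R])%E) :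
  {ae P, forall w,
      (fun n : nat => public_llr Fp Fm lr (fun k => lr (s k w)) n / n.+1%:R)
        @ \oo --> 0%R}.
Proof.
have theta_measC : measurable [set w | ~~ theta w].
  rewrite (_ : [set w | ~~ theta w] = ~` [set w | theta w]); first exact: measurableC.
  by apply/seteqP; split => w /=; move/negP.
(* Unboundedness is stated under the mixture [P]. If [Fm B] vanished, so would [Fp B] by absolute
   continuity, and both halves of the event would be null. *)
have signal_pos (B : set R) : measurable B -> (0 < P (s 0%N @^-1` B))%E ->
    (0 < Fp B)%E /\ (0 < Fm B)%E.
  move=> mB PB.
  have msB : measurable (s 0%N @^-1` B).
    by rewrite -[X in measurable X]setTI; exact: hs_meas.
  have bigcap1 : \bigcap_(i < 1) (s i @^-1` B) = s 0%N @^-1` B.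
    by apply/seteqP; split => [w /(_ 0%N)|w Bw [|]//]; exact.
  have pB := hcond_iid_p 1%N (fun=> B) (fun=> mB).
  have mB1 := hcond_iid_m 1%N (fun=> B) (fun=> mB).
  rewrite bigcap1 big_ord_recl big_ord0 mule1 in pB.
  rewrite bigcap1 big_ord_recl big_ord0 mule1 in mB1.
  have null : (Fp B = 0%R <-> Fm B = 0%R)%E.
    by split; apply: (iffLR (null_content_dominatesP _ _)).
  have Fm0 : Fm B <> 0%E.
    move=> Fm0; move: PB; rewrite ltNge => /negP; apply.
    pose A := [set w | theta w] `&` s 0%N @^-1` B.
    pose A' := [set w | ~~ theta w] `&` s 0%N @^-1` B.
    have -> : s 0%N @^-1` B = A `|` A'.
      apply/seteqP; split => [w Bw|w [[]|[]]//].
      by case: (boolP (theta w)) => ?; [left|right].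
    have : (P (A `|` A') <= P A + P A')%E by apply: measureU2; exact: measurableI.
    by rewrite pB mB1 Fm0 (iffRL null Fm0) !mule0 adde0.
  by split; rewrite lt0e measure_ge0 andbT; apply/eqP => //; rewrite null.
have unbounded (x : R) :
  [/\ (0 < Fp [set y | (lr y <= x)%R])%E, (0 < Fm [set y | (lr y <= x)%R])%E,
      (0 < Fp [set y | (x < lr y)%R])%E & (0 < Fm [set y | (x < lr y)%R])%E].
  have mle : measurable [set y | lr y <= x] by exact: measurable_llr_le.
  have mgt : measurable [set y | x < lr y] by rewrite -setC_llr_le; exact: measurableC.
  have [|pgt mgt0] := signal_pos _ mgt; first by case: (hunbounded 0%N x).
  have [|ple mle0] := signal_pos _ mle.
    (* With [M = - x] the hypothesis gives the strict event [lr < x], which is then enlarged to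
       [lr <= x]. *)
    have [_] := hunbounded 0%N (- x); rewrite opprK => /lt_le_trans; apply.
    have mlt : measurable [set w | lr (s 0%N w) < x].
      rewrite (_ : [set w | _] = setT `&` (lr \o s 0%N) @^-1` `]-oo, x[).
        exact: (measurableT_comp hlr_meas (hs_meas 0%N)).
      by rewrite setTI; apply/seteqP; split => w /=; rewrite in_itv.
    apply: le_measure; rewrite ?inE//; last by move=> w /= /ltW.
    by rewrite -[X in measurable X]setTI; exact: hs_meas.
  by split.
have half_ge0 : 0 <= (1 / 2 : R) by lra.
have aep := ae_public_llr_div_cvg_plus _ _ _ hlr_meas hlr unbounded _ _ _ _
  htheta_meas half_ge0 hs_meas hcond_iid_p.
have aem := ae_public_llr_div_cvg_minus _ _ _ hlr_meas hlr unbounded _ _ _ _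
  theta_measC half_ge0 hs_meas hcond_iid_m.
apply: filterS2 aep aem => w hp hm.
by have [tw|tw] := boolP (theta w); [exact: hp|exact: hm].
Qed.
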